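(* Let $G$ be a connected graph on at least $3$ vertices with domination number $\gamma(G)$. Then $tr(G)\leq 6\gamma(G)$, and the bound is tight (i.e. equality is attained by some such graph).
   Context: All graphs are finite, simple and undirected. $d(u,v)$ denotes the usual shortest-path distance. The triameter of a connected graph $G=(V,E)$ on at least $3$ vertices is $tr(G)=\max\{d(u,v)+d(v,w)+d(u,w): u,v,w\in V\}$. The domination number $\gamma(G)$ is the minimum size of a set $D\subseteq V$ such that every vertex outside $D$ has a neighbour in $D$. *)

(* Defs.v *)
From mathcomp Require Import all_boot.

Set Implicit Arguments.
Unset Strict Implicit.
Unset Printing Implicit Defensive.

Record sgraph := SGraph {
  svertex :> finType;
  sedge : rel svertex;
  sedge_sym : symmetric sedge;
  sedge_irrefl : irreflexive sedge }.

Section Graph.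
Variable G : sgraph.
Implicit Types (u v w x y : G) (D : {set G}).

Definition connected : Prop := forall x y, connect (@sedge G) x y.

Definition walk n x y : bool :=
  [exists p : n.-tuple G, path (@sedge G) x p && (last x p == y)].

(* A shortest walk is a path, hence has fewer than #|G| edges; the value #|G|
   is a default, taken exactly when y is not reachable from x. *)
Definition dist x y : nat := \big[minn/#|G|]_(n < #|G| | walk n x y) n.

Definition triameter : nat :=
  \max_u \max_v \max_w (dist u v + dist v w + dist u w).

Definition dominating D : bool :=
  [forall v, (v \notin D) ==> [exists u in D, sedge v u]].

Definition domination_number : nat :=
  #|[arg min_(D < [set: G] | dominating D) #|D| ]|.

Lemma dist_min n x y : walk n x y -> dist x y <= n.
Proof.
move=> wn; have [n_lt|n_ge] := ltnP n #|G|.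
  rewrite /dist; have := mem_index_enum (Ordinal n_lt).
  elim: (index_enum _) => // i r IHr; rewrite inE big_cons.
  case/orP=> [/eqP <-|/IHr le_r]; first by rewrite wn geq_minl.
  by case: ifP => // _; apply: leq_trans (geq_minr _ _) le_r.
apply: leq_trans n_ge; rewrite /dist; elim/big_ind: _ => //.
  by move=> a b la _; apply: leq_trans (geq_minl _ _) la.
by move=> i _; apply: ltnW.
Qed.

Lemma dist_walk x y : connect (@sedge G) x y -> walk (dist x y) x y.
Proof.
move=> /connectP [p0 p0P ->]; case/shortenP: p0P => p pP p_uniq _.
set y' := last x p.
have wp : walk (size p) x y' by apply/existsP; exists (in_tuple p); rewrite pP /=.
have p_lt : size p < #|G|.
  by have := max_card (mem (x :: p)); rewrite (card_uniqP p_uniq).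
have d_lt : dist x y' < #|G| by apply: leq_ltn_trans p_lt; apply: dist_min.
suff: walk (dist x y') x y' \/ dist x y' = #|G|.
  by case=> // d_eq; rewrite d_eq ltnn in d_lt.
rewrite /dist; elim/big_ind: _ => [|a b Ha Hb|i wi]; [by right| |by left].
by rewrite /minn; case: ifP.
Qed.

Lemma dominating_setT : dominating [set: G].
Proof. by apply/forallP => v; rewrite inE. Qed.

End Graph.

(* Main.v *)
Require Import Defs.
From mathcomp Require Import all_boot zify.

(** Why [tr(G) <= 6 gamma(G)].  Fix vertices [u], [v], [w], put [d := d(u,v)],
    and let [I] be the set of all vertices lying on some geodesic from [u] to
    [v].  Let [t y] be the distance from [y] to [I], and [h := t w].  Going
    from [w] to a nearest vertex of [I], and from there to [u] and to [v],
    gives [d(u,w) + d(v,w) <= d + 2h] ([perimeter_le]), so it suffices to show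
    [d + h <= 3 #|D|] for every dominating set [D].

    There are [d + 1] distances to [u] realised in [I], and [h - 1] values of
    [t] from [2] to [h], all of which are realised as well.  A vertex of [D]
    whose closed neighbourhood meets a realising vertex covers that value, and
    the point is that one vertex covers at most three of these values in total,
    of which there are [d + h] (or [d + 1], if [h = 0]):
    - a vertex of [I] covers three consecutive distances to [u], and none of
      the values of [t] above [1];
    - a vertex with [t = 1] covers only two distances to [u], because three of
      them would put it on a geodesic from [u] to [v], and it covers only the
      value [2] of [t];
    - a vertex with [t >= 2] has no neighbour in [I] and covers three
      consecutive values of [t].
    Taking all geodesics at once, instead of one of them, is what makes the
    second case work.

    The star with three leaves attains the bound: one vertex dominates it, and
    its leaves are pairwise at distance [2]. *)

Set Implicit Arguments.
Unset Strict Implicit.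
Unset Printing Implicit Defensive.

(** * Walks and the metric of a connected graph *)

Section Metric.
Variable G : sgraph.
Implicit Types (x y z : G) (m n : nat).

Lemma walkP n x y :
  reflect (exists p, [/\ size p = n, path (@sedge G) x p & last x p = y])
          (walk n x y).
Proof.
apply: (iffP existsP) => [[p /andP [pP /eqP pl]]|[p [<- pP pl]]].
  by exists p; rewrite size_tuple.
by exists (in_tuple p); rewrite pP /= pl eqxx.
Qed.

Lemma walk_cat m n x y z : walk m x y -> walk n y z -> walk (m + n) x z.
Proof.
move=> /walkP [p [<- pP pl]] /walkP [q [<- qP ql]]; apply/walkP.
by exists (p ++ q); rewrite size_cat cat_path last_cat pP pl qP ql.
Qed.

Lemma walk_split m n x z :
  walk (m + n) x z -> exists y, walk m x y /\ walk n y z.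
Proof.
move=> /walkP [p [sp pP pl]]; exists (last x (take m p)).
move: pP pl; rewrite -{1 2}(cat_take_drop m p) cat_path last_cat.
move=> /andP [tP dP] dl; split; apply/walkP.
  by exists (take m p); rewrite size_take_min sp (minn_idPl (leq_addr _ _)).
by exists (drop m p); rewrite size_drop sp addKn.
Qed.

Lemma walk_rev n x y : walk n x y -> walk n y x.
Proof.
move=> /walkP [p [sp pP pl]]; apply/walkP; exists (rev (belast x p)).
rewrite size_rev size_belast -pl rev_path; split=> //.
  by rewrite (eq_path (e' := @sedge G)) // => a b; rewrite sedge_sym.
by case: p {sp pP pl} => //= a p; rewrite rev_cons last_rcons.
Qed.

Lemma dist_refl x : dist x x = 0.
Proof.
by apply/eqP; rewrite -leqn0; apply: dist_min; apply/walkP; exists [::].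
Qed.

Lemma dist_edge x y : sedge x y -> dist x y <= 1.
Proof.
by move=> xy; apply: dist_min; apply/walkP; exists [:: y]; rewrite /= xy.
Qed.

Lemma dominating_dist (D : {set G}) x :
  dominating D -> exists2 z, z \in D & dist x z <= 1.
Proof.
move=> /forallP/(_ x)/implyP domD; have [xD|xND] := boolP (x \in D).
  by exists x; rewrite ?dist_refl.
have /existsP [z /andP [zD xz]] := domD xND.
by exists z => //; apply: dist_edge.
Qed.

Hypothesis Gconn : connected G.

Lemma dist_sym x y : dist x y = dist y x.
Proof.
by apply/eqP; rewrite eqn_leq !dist_min //; apply/walk_rev/dist_walk/Gconn.
Qed.

Lemma dist_triangle y x z : dist x z <= dist x y + dist y z.
Proof. by apply/dist_min/(walk_cat (y := y)); apply/dist_walk/Gconn. Qed.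

Lemma dist_gt1 x y : x != y -> ~~ sedge x y -> 1 < dist x y.
Proof.
move=> xy xyE; have := dist_walk (Gconn x y).
case: (dist x y) => [|[|//]] /walkP [p [sp pP pl]].
  by case: p sp pl xy {pP} => //= _ ->; rewrite eqxx.
case: p sp pP pl xyE => [|a [|]] //= _; rewrite andbT => xa ay.
by rewrite -ay xa.
Qed.

Lemma geodesic_point x z n :
  n <= dist x z -> exists y, dist x y = n /\ dist y z = dist x z - n.
Proof.
move=> nxz; have := dist_walk (Gconn x z); rewrite -{1}(subnKC nxz).
case/walk_split=> y [/dist_min xy /dist_min yz].
by exists y; have := dist_triangle y x z; lia.
Qed.

End Metric.

(** * Covering integers by intervals *)

Lemma interval_cover (T : finType) (D : {set T}) (a len : T -> nat) b n :
  (forall i, b <= i < b + n -> exists2 z, z \in D & a z <= i < a z + len z) ->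
  n <= \sum_(z in D) len z.
Proof.
move=> cover; rewrite -(size_iota b n).
have -> : \sum_(z in D) len z =
          size (flatten [seq iota (a z) (len z) | z <- enum D]).
  rewrite size_flatten /shape -map_comp sumnE big_map big_enum /=.
  by apply: eq_bigr => z _; rewrite size_iota.
apply: uniq_leq_size (iota_uniq _ _) _ => i; rewrite mem_iota => /cover [z zD zi].
by apply/flatten_mapP; exists z; rewrite ?mem_enum // mem_iota.
Qed.

(** * The perimeter of three vertices and dominating sets *)

Section Perimeter.
Variable G : sgraph.
Hypothesis Gconn : connected G.
Variables u v : G.
Implicit Types (w x y z : G) (D : {set G}).

Definition between x : bool := dist u x + dist x v == dist u v.

Definition between_dist y : nat :=
  dist [arg min_(x < u | between x) dist x y] y.

Lemma between_left : between u.
Proof. by rewrite /between dist_refl. Qed.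

Lemma between_dist_le x y : between x -> between_dist y <= dist x y.
Proof.
by rewrite /between_dist; case: arg_minnP => [|z _ zmin]; last exact: zmin;
  exact: between_left.
Qed.

Lemma between_dist_attained y : exists2 x, between x & between_dist y = dist x y.
Proof.
rewrite /between_dist; case: arg_minnP => [|x bx _]; first exact: between_left.
by exists x.
Qed.

Lemma between_dist_gt0 y : ~~ between y -> 0 < between_dist y.
Proof.
move=> yN; have [x bx ->] := between_dist_attained y.
rewrite lt0n; apply: contra yN => /eqP xy0; move: bx; rewrite /between => bx.
have := dist_triangle Gconn x u y; have := dist_triangle Gconn x y v.
have := dist_triangle Gconn y u v; rewrite (dist_sym Gconn y x); lia.
Qed.

Lemma between_dist_triangle y z : between_dist y <= between_dist z + dist z y.
Proof.
have [x bx ->] := between_dist_attained z.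
exact: leq_trans (between_dist_le y bx) (dist_triangle Gconn z x y).
Qed.

Lemma between_dist_onto w n :
  n <= between_dist w -> exists y, between_dist y = n.
Proof.
have [x bx wx] := between_dist_attained w; rewrite wx => nw.
have [y [xy yw]] := geodesic_point Gconn nw; exists y.
have := between_dist_le y bx; have := between_dist_triangle w y; lia.
Qed.

Lemma perimeter_le w :
  dist u v + dist v w + dist u w <= 2 * (dist u v + between_dist w).
Proof.
have [x] := between_dist_attained w; rewrite /between => bx ->.
have := dist_triangle Gconn x u w; have := dist_triangle Gconn x v w.
rewrite (dist_sym Gconn v x); lia.
Qed.

(** How many distances to [u] of vertices between [u] and [v] a single vertex
    [z] can cover; the rest of a budget of [3] is what [z] can cover among the
    values of [between_dist] above [1]. *)
Definition along_capacity z : nat :=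
  match between_dist z with 0 => 3 | 1 => 2 | _ => 0 end.

Lemma along_cover D :
  dominating D -> (dist u v).+1 <= \sum_(z in D) along_capacity z.
Proof.
move=> domD; apply: (@interval_cover _ _ (fun z => (dist u z).-1) _ 0).
move=> i; rewrite add0n ltnS /= => iuv.
have [x [ux xv]] := geodesic_point Gconn iuv.
have [z zD xz] := dominating_dist x domD; exists z => //.
have bx : between x by rewrite /between; lia.
have tz := between_dist_le z bx.
have uz := dist_triangle Gconn x u z; have uzx := dist_triangle Gconn z u x.
have zv := dist_triangle Gconn x z v; have uzv := dist_triangle Gconn z u v.
rewrite (dist_sym Gconn z x) in uzx zv.
rewrite /along_capacity; have [bz|bzN] := boolP (between z).
  by have := between_dist_le z bz; rewrite dist_refl leqn0 => /eqP ->; lia.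
(* Here [d(u,z) + d(z,v)] exceeds [d(u,v)], which excludes [i = d(u,z) + 1]. *)
have := between_dist_gt0 bzN; move: bzN; rewrite /between => bzN tz0.
have -> : between_dist z = 1 by lia.
by move: bzN; lia.
Qed.

Lemma away_cover D w : dominating D ->
  (between_dist w).-1 <= \sum_(z in D) (3 - along_capacity z).
Proof.
move=> domD.
(* A vertex with [between_dist z = 1] gets the interval [{2}], any farther one
   the three values around its own. *)
apply: (@interval_cover _ _ (fun z => maxn 2 (between_dist z).-1) _ 2) => j jP.
have [|y ty] := @between_dist_onto w j; first lia.
have [z zD yz] := dominating_dist y domD; exists z => //.
have := between_dist_triangle y z; have := between_dist_triangle z y.
rewrite ty (dist_sym Gconn z y) /along_capacity.
by case: (between_dist z) => [|[|t]]; lia.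
Qed.

Lemma perimeter_dominating D w :
  dominating D -> dist u v + dist v w + dist u w <= 6 * #|D|.
Proof.
move=> domD; apply: leq_trans (perimeter_le w) _.
suff : (dist u v).+1 + (between_dist w).-1 <= 3 * #|D| by lia.
apply: leq_trans (leq_add (along_cover domD) (away_cover w domD)) _.
rewrite -big_split /= mulnC -sum_nat_const; apply: leq_sum => z _.
by rewrite /along_capacity; case: between_dist => [|[|]].
Qed.

End Perimeter.

(** * The domination number and the extremal star *)

Lemma domination_number_attained (G : sgraph) :
  exists2 D : {set G}, dominating D & domination_number G = #|D|.
Proof.
rewrite /domination_number; case: arg_minnP => [|D domD _].
  exact: dominating_setT.
by exists D.
Qed.

Lemma domination_number_le (G : sgraph) (D : {set G}) :
  dominating D -> domination_number G <= #|D|.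
Proof.
move=> domD; rewrite /domination_number; case: arg_minnP => [|D' _ D'min].
  exact: dominating_setT.
exact: D'min.
Qed.

Lemma perimeter_le_triameter (G : sgraph) (u v w : G) :
  dist u v + dist v w + dist u w <= triameter G.
Proof.
rewrite /triameter; apply: (bigmax_sup u) => //; apply: (bigmax_sup v) => //.
exact: (bigmax_sup w).
Qed.

Lemma triameter_le_domination (G : sgraph) :
  connected G -> triameter G <= 6 * domination_number G.
Proof.
move=> Gconn; have [D domD ->] := domination_number_attained G.
apply/bigmax_leqP => u _; apply/bigmax_leqP => v _; apply/bigmax_leqP => w _.
exact: perimeter_dominating.
Qed.

Definition claw_rel : rel 'I_4 := fun x y => (x == ord0) (+) (y == ord0).

Lemma claw_sym : symmetric claw_rel.
Proof. by move=> x y; rewrite /claw_rel addbC. Qed.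

Lemma claw_irrefl : irreflexive claw_rel.
Proof. by move=> x; rewrite /claw_rel addbb. Qed.

Definition claw : sgraph := SGraph claw_sym claw_irrefl.

Lemma claw_connected : connected claw.
Proof.
have centre (x : claw) : connect (@sedge claw) ord0 x.
  have [->|x0] := eqVneq x ord0; first exact: connect0.
  by apply: connect1; rewrite /= /claw_rel (negPf x0).
move=> x y; apply: (connect_trans _ (centre y)).
by rewrite (sym_connect_sym (@sedge_sym claw)).
Qed.

Lemma claw_triameter : triameter claw = 6 * domination_number claw.
Proof.
apply/eqP; rewrite eqn_leq (triameter_le_domination claw_connected) /=.
have dom1 : domination_number claw <= 1.
  rewrite -(cards1 (ord0 : claw)); apply: domination_number_le.
  apply/forallP => x; apply/implyP; rewrite inE => x0.
  by apply/existsP; exists ord0; rewrite inE eqxx /= /claw_rel (negPf x0).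
apply: (@leq_trans 6); first lia.
pose leaf i : claw := lift ord0 (i : 'I_3).
have leaf_dist i j : i != j -> 1 < dist (leaf i) (leaf j).
  by move=> ij; apply: (dist_gt1 claw_connected).
apply: leq_trans (perimeter_le_triameter (leaf (inord 0)) (leaf (inord 1))
                                         (leaf (inord 2))).
have inord_neq a b : a < 3 -> b < 3 -> a != b -> inord a != inord b :> 'I_3.
  by move=> a3 b3; rewrite -val_eqE /= !inordK.
by rewrite (@leq_add 4 2) ?(@leq_add 2 2) ?leaf_dist ?inord_neq.
Qed.

Theorem corollary3p6 :
  (forall G : sgraph, connected G -> 3 <= #|G| ->
     triameter G <= 6 * domination_number G) /\
  (exists G : sgraph, [/\ connected G, 3 <= #|G| &
     triameter G = 6 * domination_number G]).
Proof.
split=> [G Gconn _|]; first exact: triameter_le_domination.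
exists claw; split; first exact: claw_connected.
  by rewrite card_ord.
exact: claw_triameter.
Qed.
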